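(* Let $A\in\mathbb{R}^{m\times n}$, $\tilde A\in\mathbb{R}^{m\times c}$, and let $P\in\mathbb{R}^{m\times m}$ be an orthogonal projector ($P^2=P=P^T$) with $\operatorname{rank}(P)=c$. Then $$\Big|\,\|(I-P)A\|_2^2-\|(I-P)\tilde A\|_2^2\,\Big|\ \le\ \|AA^T-\tilde A\tilde A^T\|_2.$$ If also $\operatorname{rank}(\tilde A)=c$, then $$\|(I-\tilde A\tilde A^{\dagger})A\|_2^2\ \le\ \|AA^T-\tilde A\tilde A^T\|_2.$$ If $\tilde A_k\in\mathbb{R}^{m\times c}$ is a best rank-$k$ approximation of $\tilde A$ with $\operatorname{rank}(\tilde A_k)=k<c$, then $$\|(I-\tilde A_k\tilde A_k^{\dagger})A\|_2^2\ \le\ \|A-A_k\|_2^2+2\,\|AA^T-\tilde A\tilde A^T\|_2.$$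
   Context: $\|\cdot\|_2$ is the matrix two-norm (largest singular value) and $M^{\dagger}$ is the Moore-Penrose inverse. For a matrix $M$ with full SVD $M=U\Sigma V^T$ (singular values in non-increasing order) and $1\le k\le\operatorname{rank}(M)$, a best rank-$k$ approximation of $M$ is the truncated SVD $M_k=U_k\Sigma_kV_k^T=U_kU_k^TM$, where $U_k,V_k$ are the leading $k$ columns of $U,V$ and $\Sigma_k$ is the diagonal matrix of the $k$ largest singular values. $A_k$ denotes such a best rank-$k$ approximation of $A$, where $1\le k\le\operatorname{rank}(A)$. *)

(* Defs.v *)
From mathcomp Require Import all_boot all_order all_algebra.
From mathcomp Require Import all_classical all_reals.

Set Implicit Arguments.
Unset Strict Implicit.
Unset Printing Implicit Defensive.

Import Order.TTheory GRing.Theory Num.Theory.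

Local Open Scope ring_scope.
Local Open Scope classical_set_scope.

Definition orthogonal_mx (R : realType) (n : nat) (U : 'M[R]_n) : Prop :=
  U^T *m U = 1%:M.

Definition orthogonal_projector (R : realType) (m : nat) (P : 'M[R]_m) : Prop :=
  P *m P = P /\ P^T = P.

(* Full SVD: S has the shape of M.  The hypotheses [i = j :> nat] single out
   the diagonal entries of the possibly rectangular matrix S. *)
Definition full_svd (R : realType) (m n : nat) (M : 'M[R]_(m, n))
    (U : 'M[R]_m) (S : 'M[R]_(m, n)) (V : 'M[R]_n) : Prop :=
  [/\ orthogonal_mx U, orthogonal_mx V & M = U *m S *m V^T] /\
  [/\ (forall (i : 'I_m) (j : 'I_n), i <> j :> nat -> S i j = 0),
      (forall (i : 'I_m) (j : 'I_n), i = j :> nat -> 0 <= S i j) &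
      (forall (i i' : 'I_m) (j j' : 'I_n), i = j :> nat -> i' = j' :> nat ->
         (i <= i')%N -> S i' j' <= S i j)].

Definition singular_values (R : realType) (m n : nat) (M : 'M[R]_(m, n)) :
    set R :=
  [set s | exists (U : 'M[R]_m) (S : 'M[R]_(m, n)) (V : 'M[R]_n),
     full_svd M U S V /\
     exists (i : 'I_m) (j : 'I_n), i = j :> nat /\ s = S i j].

(* The singular values do not depend on the SVD, so the set is finite and its
   supremum is its maximum; it is empty, with sup 0, only when m or n is 0. *)
Definition norm2 (R : realType) (m n : nat) (M : 'M[R]_(m, n)) : R :=
  sup (singular_values M).

Definition is_moore_penrose (R : realType) (m n : nat) (M : 'M[R]_(m, n))
    (X : 'M[R]_(n, m)) : Prop :=
  [/\ M *m X *m M = M, X *m M *m X = X,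
      (M *m X)^T = M *m X & (X *m M)^T = X *m M].

(* Unlike [pinvmx], which is only some generalized inverse, this is the unique
   solution of the four Penrose equations; the default 0 is never used. *)
Definition moore_penrose (R : realType) (m n : nat) (M : 'M[R]_(m, n)) :
    'M[R]_(n, m) :=
  xget 0 [set X | is_moore_penrose M X].

(* The matrices U_k S_k V_k^T over all full SVDs of M; such a matrix need not
   be unique when the k-th and (k+1)-st singular values coincide. *)
Definition best_rank_approx (R : realType) (m n : nat) (k : nat)
    (M Mk : 'M[R]_(m, n)) : Prop :=
  (1 <= k <= \rank M)%N /\
  exists (U : 'M[R]_m) (S : 'M[R]_(m, n)) (V : 'M[R]_n)
         (km : (k <= m)%N) (kn : (k <= n)%N),
    full_svd M U S V /\
    Mk = colsub (widen_ord km) U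
         *m mxsub (widen_ord km) (widen_ord kn) S
         *m (colsub (widen_ord kn) V)^T.

(* Main.v *)
Require Import Defs.
From mathcomp Require Import all_boot all_order all_algebra.
From mathcomp Require Import all_classical all_reals.
From mathcomp Require Import topology normedtype derive.
From mathcomp Require Import ring lra.

Set Implicit Arguments.
Unset Strict Implicit.
Unset Printing Implicit Defensive.

Import Order.TTheory GRing.Theory Num.Theory.
Import numFieldTopology.Exports numFieldNormedType.Exports.

Local Open Scope ring_scope.

(** Everything rests on one variational description of the two-norm:
    [norm2 M ^+ 2] is the least nonnegative [t] such that
    |M x|^2 <= t |x|^2 for all columns [x] ([sqn_mulmx_norm2] and
    [norm2_sqr_le]), and transposition does not change the norm ([norm2_tr]).
    Since [norm2] is a supremum over all full SVDs, this requires that an SVD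
    exists ([svd_exists]).  It is built by deflation: a unit vector maximizing
    |M x| exists by compactness of the sphere, Householder reflections make it
    and its image the first basis vectors, and maximality makes the remaining
    entries of the first row vanish, so that induction applies to the remaining
    block.

    Write B for [At] and D for A A^T - B B^T.  Since |A^T z|^2 = <z, A A^T z>, the quantities
    |A^T z|^2 and |B^T z|^2 differ by <z, D z>, hence by at most
    ||D||_2 |z|^2 ([sqn_gram_le]).  Taking z = Q y for an orthogonal projector Q,
    which is a contraction, and the supremum over unit vectors y gives
    ||Q A||^2 <= ||Q B||^2 + ||D|| ([norm2_residual_le]).  This inequality and
    the one with A and B exchanged are the first claim, for Q = I - P.

    For any matrix M, the Penrose equations say that M M^+ is an orthogonal
    projector fixing M, so Q = I - M M^+ annihilates M.  With M = B the term
    ||Q B|| vanishes, which is the second claim.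

    For the third claim let M = B_k, so that Q B = Q (B - B_k) and
    ||Q B|| <= ||B - B_k||, and the latter is the largest singular value of B
    left out by the truncation, or 0 if none is.  Each such singular value s_i, i >= k counting
    from 0, satisfies s_i^2 <= ||A - A_k||^2 + ||D||
    ([svd_entry_le_low_rank]): the i + 1 leading left singular vectors of B
    span a space on which B^T stretches by at least s_i, and, A_k having rank
    at most k <= i, this space contains a nonzero w with A_k^T w = 0, for which
    s_i^2 |w|^2 <= |B^T w|^2 <= |A^T w|^2 + ||D|| |w|^2
    and A^T w = (A - A_k)^T w.  Using ||D|| once in [norm2_residual_le] and once
    here produces the factor 2. *)

(** * The Euclidean inner product on columns *)

Definition dotv (R : realType) (n : nat) (x y : 'cV[R]_n) : R := (x^T *m y) 0 0.

Definition sqn (R : realType) (n : nat) (x : 'cV[R]_n) : R := dotv x x.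

Lemma dotvE (R : realType) (n : nat) (x y : 'cV[R]_n) :
  dotv x y = \sum_i x i 0 * y i 0.
Proof. by rewrite /dotv mxE; apply: eq_bigr => i _; rewrite mxE. Qed.

Lemma sqnE (R : realType) (n : nat) (x : 'cV[R]_n) : sqn x = \sum_i x i 0 ^+ 2.
Proof. by rewrite /sqn dotvE; apply: eq_bigr => i _; rewrite expr2. Qed.

Lemma sqn_ge0 (R : realType) (n : nat) (x : 'cV[R]_n) : 0 <= sqn x.
Proof. by rewrite sqnE; apply: sumr_ge0 => i _; apply: sqr_ge0. Qed.

Lemma sqn_eq0 (R : realType) (n : nat) (x : 'cV[R]_n) : (sqn x == 0) = (x == 0).
Proof.
rewrite sqnE psumr_eq0; last by move=> i _; apply: sqr_ge0.
apply/allP/eqP => [x0|-> i _]; last by rewrite /= mxE expr0n.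
apply/colP => i; rewrite mxE; apply/eqP.
by have := x0 i (mem_index_enum _); rewrite /= sqrf_eq0.
Qed.

Lemma sqn0 (R : realType) (n : nat) : sqn (0 : 'cV[R]_n) = 0.
Proof. by apply/eqP; rewrite sqn_eq0. Qed.

Lemma sqn_delta (R : realType) (n : nat) (i : 'I_n) :
  sqn (delta_mx i 0 : 'cV[R]_n) = 1.
Proof.
rewrite sqnE (bigD1 i) //= big1 ?addr0 ?mxE ?eqxx ?expr1n // => l li.
by rewrite mxE (negbTE li) expr0n.
Qed.

Lemma dotvC (R : realType) (n : nat) (x y : 'cV[R]_n) : dotv x y = dotv y x.
Proof. by rewrite !dotvE; apply: eq_bigr => i _; rewrite mulrC. Qed.

Lemma dotvDr (R : realType) (n : nat) (x y z : 'cV[R]_n) :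
  dotv x (y + z) = dotv x y + dotv x z.
Proof. by rewrite /dotv mulmxDr mxE. Qed.

Lemma dotvNr (R : realType) (n : nat) (x y : 'cV[R]_n) :
  dotv x (- y) = - dotv x y.
Proof. by rewrite /dotv mulmxN mxE. Qed.

Lemma dotvZr (R : realType) (n : nat) (a : R) (x y : 'cV[R]_n) :
  dotv x (a *: y) = a * dotv x y.
Proof. by rewrite /dotv -scalemxAr mxE. Qed.

Lemma dotv_mulmx (R : realType) (m n : nat) (M : 'M[R]_(m, n)) x y :
  dotv x (M *m y) = dotv (M^T *m x) y.
Proof. by rewrite /dotv trmx_mul trmxK mulmxA. Qed.

Lemma sqnD (R : realType) (n : nat) (x y : 'cV[R]_n) :
  sqn (x + y) = sqn x + 2 * dotv x y + sqn y.
Proof.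
rewrite /sqn !dotvDr ![dotv (x + y) _]dotvC !dotvDr (dotvC y x); ring.
Qed.

Lemma sqnB (R : realType) (n : nat) (x y : 'cV[R]_n) :
  sqn (x - y) = sqn x - 2 * dotv x y + sqn y.
Proof. by rewrite sqnD dotvNr /sqn dotvNr [dotv (- _) _]dotvC dotvNr; ring. Qed.

Lemma sqnZ (R : realType) (n : nat) (a : R) (x : 'cV[R]_n) :
  sqn (a *: x) = a ^+ 2 * sqn x.
Proof. by rewrite /sqn dotvZr dotvC dotvZr; ring. Qed.

(** The nonnegative number |(y,y) x - (x,y) y|^2 equals (y,y) times the
    difference of the two sides. *)
Lemma dotv_CauchySchwarz (R : realType) (n : nat) (x y : 'cV[R]_n) :
  dotv x y ^+ 2 <= sqn x * sqn y.
Proof.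
have [->|y0] := eqVneq y 0.
  by rewrite /dotv mulmx0 mxE expr0n mulr_ge0 ?sqn_ge0.
have ygt0 : 0 < sqn y by rewrite lt_def sqn_eq0 y0 sqn_ge0.
have := sqn_ge0 (sqn y *: x - dotv x y *: y).
rewrite sqnB !sqnZ dotvZr [dotv (_ *: _) _]dotvC dotvZr [dotv y x]dotvC => h.
rewrite -subr_ge0 -(pmulr_rge0 _ ygt0); apply: le_trans h _.
by rewrite le_eqVlt; apply/orP; left; apply/eqP; ring.
Qed.

Lemma sqn_mulmx_frobenius (R : realType) (m n : nat) (M : 'M[R]_(m, n)) x :
  sqn (M *m x) <= (\sum_i sqn (row i M)^T) * sqn x.
Proof.
rewrite sqnE mulr_suml; apply: ler_sum => i _.
suff -> : (M *m x) i 0 = dotv (row i M)^T x by apply: dotv_CauchySchwarz.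
by rewrite mxE dotvE; apply: eq_bigr => j _; rewrite !mxE.
Qed.

Lemma dotv_quad_le (R : realType) (n : nat) (M : 'M[R]_n) (s : R) :
  0 <= s -> (forall x, sqn (M *m x) <= s ^+ 2 * sqn x) ->
  forall x, `|dotv x (M *m x)| <= s * sqn x.
Proof.
move=> s0 Ms x; rewrite -ler_sqr ?nnegrE ?mulr_ge0 ?sqn_ge0 //.
rewrite real_normK ?num_real //; apply: le_trans (dotv_CauchySchwarz _ _) _.
apply: le_trans (ler_wpM2l (sqn_ge0 x) (Ms x)) _.
by rewrite mulrCA -expr2 exprMn.
Qed.

(** * Orthogonal and diagonal matrices *)

Lemma orthogonal_mulmx_tr (R : realType) (n : nat) (U : 'M[R]_n) :
  orthogonal_mx U -> U *m U^T = 1%:M.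
Proof. exact: mulmx1C. Qed.

Lemma orthogonal_mx_tr (R : realType) (n : nat) (U : 'M[R]_n) :
  orthogonal_mx U -> orthogonal_mx U^T.
Proof. by rewrite /orthogonal_mx trmxK => /mulmx1C. Qed.

Lemma orthogonal_mx_mul (R : realType) (n : nat) (U V : 'M[R]_n) :
  orthogonal_mx U -> orthogonal_mx V -> orthogonal_mx (U *m V).
Proof.
rewrite /orthogonal_mx trmx_mul => oU oV.
by rewrite mulmxA -(mulmxA V^T) oU mulmx1.
Qed.

Lemma sqn_orthogonal (R : realType) (m n : nat) (U : 'M[R]_(m, n)) x :
  U^T *m U = 1%:M -> sqn (U *m x) = sqn x.
Proof. by move=> oU; rewrite /sqn dotv_mulmx mulmxA oU mul1mx. Qed.

(** A row of a rectangular diagonal matrix has at most one nonzero entry, in the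
    column with the same index, and has none when that index is out of range;
    hence [a] is a natural number and not an element of ['I_n]. *)
Lemma sum_sqr_single (R : realType) (n : nat) (F : 'I_n -> R) (a : nat) :
  (forall b : 'I_n, a <> b -> F b = 0) ->
  (\sum_b F b) ^+ 2 = \sum_b F b ^+ 2.
Proof.
move=> F0; have [an|na] := ltnP a n; last first.
  have F00 b : F b = 0.
    by apply: F0 => ab; move: (ltn_ord b); rewrite -ab ltnNge na.
  by rewrite !big1 ?expr0n // => b _; rewrite F00 ?expr0n.
have F0' b : b != Ordinal an -> F b = 0.
  by move=> bn; apply: F0 => ab; case/eqP: bn; apply: val_inj.
rewrite (bigD1 (Ordinal an)) //= [in RHS](bigD1 (Ordinal an)) //=.
by rewrite !big1 ?addr0 // => b /F0' ->; rewrite ?expr0n.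
Qed.

Lemma sqn_diag (R : realType) (m n : nat) (S : 'M[R]_(m, n)) (y : 'cV[R]_n) :
  (forall (i : 'I_m) (j : 'I_n), i <> j :> nat -> S i j = 0) ->
  sqn (S *m y) = \sum_j (\sum_i S i j ^+ 2) * y j 0 ^+ 2.
Proof.
move=> dS; rewrite sqnE.
under eq_bigr => i _.
  rewrite mxE (@sum_sqr_single _ _ _ i); last by move=> j /dS ->; rewrite mul0r.
  over.
rewrite exchange_big; apply: eq_bigr => j _; rewrite mulr_suml.
by apply: eq_bigr => i _; rewrite exprMn.
Qed.

Lemma sqn_diag_le (R : realType) (m n : nat) (S : 'M[R]_(m, n)) (t : R) y :
  (forall (i : 'I_m) (j : 'I_n), i <> j :> nat -> S i j = 0) ->
  (forall (i : 'I_m) (j : 'I_n), i = j :> nat -> S i j ^+ 2 <= t) ->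
  0 <= t -> sqn (S *m y) <= t * sqn y.
Proof.
move=> dS tS t0; rewrite sqn_diag // sqnE mulr_sumr; apply: ler_sum => j _.
apply: ler_wpM2r; first exact: sqr_ge0.
rewrite -(@sum_sqr_single _ _ (fun i => S i j) j); last first.
  by move=> i ij; apply: dS => /esym.
have [jm|mj] := ltnP j m; last first.
  rewrite big1 ?expr0n // => i _; apply: dS => ij.
  by move: (ltn_ord i); rewrite ij ltnNge mj.
rewrite (bigD1 (Ordinal jm)) //= big1 ?addr0 ?tS // => i ij.
by apply: dS => /= ij'; case/eqP: ij; apply: val_inj.
Qed.

(** The entry in row i and column j of S is a coordinate of S e_j, and
    |S e_j| = |M (V e_j)| with V e_j a unit vector. *)
Lemma svd_entry_le (R : realType) (m n : nat) (M : 'M[R]_(m, n)) U S V (t : R) :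
  full_svd M U S V -> (forall x, sqn (M *m x) <= t * sqn x) ->
  forall i j, S i j ^+ 2 <= t.
Proof.
move=> [[oU oV eM] _] Mt i j; have := Mt (V *m delta_mx j 0).
rewrite (sqn_orthogonal _ oV) sqn_delta mulr1 eM -!mulmxA (mulmxA V^T) oV.
rewrite mul1mx (sqn_orthogonal _ oU); apply: le_trans.
rewrite -colE sqnE (bigD1 i) //= mxE lerDl.
by apply: sumr_ge0 => l _; apply: sqr_ge0.
Qed.

(** * Existence of singular value decompositions *)

(** For u <> e, take the reflection in the hyperplane orthogonal to u - e. *)
Lemma householder (R : realType) (n : nat) (e u : 'cV[R]_n) :
  sqn e = 1 -> sqn u = 1 -> exists2 H, orthogonal_mx H & H *m e = u.
Proof.
move=> e1 u1; have [->|ue] := eqVneq u e.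
  by exists 1%:M; rewrite /orthogonal_mx ?trmx1 mul1mx.
pose w := u - e; pose H : 'M[R]_n := 1%:M - (2 / sqn w) *: (w *m w^T).
have w0 : sqn w != 0 by rewrite sqn_eq0 subr_eq0.
have ww : w^T *m w = (sqn w)%:M by rewrite [LHS]mx11_scalar.
have HT : H^T = H by rewrite /H linearB linearZ /= trmx1 trmx_mul trmxK.
have WW : w *m w^T *m (w *m w^T) = sqn w *: (w *m w^T).
  by rewrite mulmxA -(mulmxA w) ww mul_mx_scalar -scalemxAl.
exists H.
  rewrite /orthogonal_mx HT /H mulmxBl mul1mx mulmxBr mulmx1.
  rewrite -scalemxAl -scalemxAr WW !scalerA -scalerBl -addrA -opprD -scalerDl.
  by rewrite [X in X *: _](_ : _ = 0) ?scale0r ?subr0 //; field.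
rewrite /H mulmxBl mul1mx -scalemxAl -mulmxA.
have -> : w^T *m e = (dotv w e)%:M by rewrite [LHS]mx11_scalar.
rewrite mul_mx_scalar scalerA.
have we : sqn w = - 2 * dotv w e.
  have -> : dotv w e = dotv u e - 1.
    by rewrite dotvC dotvDr dotvNr [dotv e e]e1 dotvC.
  by rewrite sqnB u1 e1; ring.
have d0 : dotv w e != 0 by apply: contraNneq w0 => d0; rewrite we d0 mulr0.
have -> : 2 / sqn w * dotv w e = -1 by rewrite we; field.
by rewrite scaleN1r opprK /w addrC subrK.
Qed.

(** Stated on rows because the compactness criterion for closed bounded sets
    is about row vectors. *)
Lemma sqn_mulmx_tr_continuous (R : realType) (m n : nat) (M : 'M[R]_(m, n)) :
  continuous (fun y : 'rV[R]_n => sqn (M *m y^T)).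
Proof.
rewrite (_ : (fun y => _) =
  fun y : 'rV[R]_n => \sum_i (\sum_j M i j * y 0 j) ^+ 2); last first.
  apply/funext => y; rewrite sqnE; apply: eq_bigr => i _; rewrite mxE.
  by congr (_ ^+ 2); apply: eq_bigr => j _; rewrite mxE.
have cL i : continuous (fun y : 'rV[R]_n => \sum_j M i j * y 0 j).
  apply: continuous_big => [|j _ y]; first exact: add_continuous.
  by apply: continuousM; [exact: cst_continuous | exact: coord_continuous].
apply: continuous_big => [|i _ y]; first exact: add_continuous.
exact: continuousM (cL i y) (cL i y).
Qed.

(** A continuous function attains its maximum on the unit sphere, and both
    sides of the inequality are homogeneous of degree 2 in [x]. *)
Lemma max_gain_exists (R : realType) (m n : nat) (M : 'M[R]_(m, n.+1)) :
  exists2 v, sqn v = 1 & forall x, sqn (M *m x) <= sqn (M *m v) * sqn x.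
Proof.
pose A := [set y : 'rV[R]_n.+1 | sqn y^T = 1]%classic.
have A0 : (A !=set0)%classic.
  by exists (delta_mx 0 0); rewrite /A /= trmx_delta sqn_delta.
have cA : compact A.
  apply: bounded_closed_compact.
    exists 1; split=> // t t1 y /= y1; apply: le_trans (ltW t1).
    rewrite [leLHS]/Num.norm /= mx_normrE; apply/bigmax_leP.
    split=> // -[i j] _ /=.
    rewrite -(@ler_pXn2r _ 2) ?nnegrE // expr1n real_normK ?num_real //.
    rewrite -y1 sqnE (bigD1 j) //= mxE (ord1 i) lerDl.
    by apply: sumr_ge0 => l _; apply: sqr_ge0.
  rewrite (_ : A = (fun y => sqn (1%:M *m y^T)) @^-1` [set 1])%classic; last first.
    by apply/seteqP; split=> y /=; rewrite mul1mx.
  apply: closed_comp; last exact: closed_eq.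
  by move=> y _; apply: sqn_mulmx_tr_continuous.
have [|v] := compact_EVT_max A0 cA (f := fun y => sqn (M *m y^T)).
  by apply: continuous_subspaceT; apply: sqn_mulmx_tr_continuous.
rewrite inE => v1 vmax; exists v^T => // x.
have [->|x0] := eqVneq x 0; first by rewrite mulmx0 !sqn0 mulr0.
have xgt0 : 0 < sqn x by rewrite lt_def sqn_eq0 x0 sqn_ge0.
have := vmax ((Num.sqrt (sqn x))^-1 *: x^T).
rewrite inE /A /= linearZ /= trmxK -scalemxAr !sqnZ exprVn sqr_sqrtr ?sqn_ge0 //.
rewrite mulVf ?gt_eqF // => /(_ erefl).
by rewrite ler_pdivrMl // mulrC.
Qed.

Lemma sqn_col_mx (R : realType) (m n : nat) (x : 'cV[R]_m) (y : 'cV[R]_n) :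
  sqn (col_mx x y) = sqn x + sqn y.
Proof. by rewrite /sqn /dotv tr_col_mx mul_row_col mxE. Qed.

(** One step of the construction of an SVD.  If v maximizes |M v| on the unit
    sphere and M v = s u with u a unit vector, reflections sending the first
    basis vector to u and to v put M in a form whose first column is
    (s, 0, ..., 0).  The first row is then (s, 0, ..., 0) as well, for a nonzero
    tail would give a vector stretched by more than s.  The bound on the
    remaining block is kept, since it is what makes the singular values found
    later at most s. *)
Lemma svd_deflation (R : realType) (m n : nat) (M : 'M[R]_(1 + m, 1 + n)) :
  exists (U : 'M[R]_(1 + m)) (s : R) (B : 'M[R]_(m, n)) (V : 'M[R]_(1 + n)),
    [/\ orthogonal_mx U, orthogonal_mx V, 0 <= s,
        forall x, sqn (B *m x) <= s ^+ 2 * sqn x &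
        M = U *m block_mx s%:M 0 0 B *m V^T].
Proof.
have [v v1 vmax] := max_gain_exists M.
pose s := Num.sqrt (sqn (M *m v)).
have s0 : 0 <= s by apply: sqrtr_ge0.
have s2 : s ^+ 2 = sqn (M *m v) by rewrite sqr_sqrtr ?sqn_ge0.
(* When s = 0 any unit vector can serve as u. *)
have [u u1 Mv] : exists2 u, sqn u = 1 & M *m v = s *: u.
  have [s00|sn0] := eqVneq s 0.
    exists (delta_mx 0 0); first exact: sqn_delta.
    rewrite s00 scale0r; apply/eqP.
    by rewrite -sqn_eq0 -s2 s00 expr0n.
  exists (s^-1 *: (M *m v)); last by rewrite scalerA divff // scale1r.
  by rewrite sqnZ -s2 exprVn mulVf ?sqrf_eq0.
have [U1 oU1 U1e] := householder (sqn_delta R (0 : 'I_(1 + m))) u1.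
have [V1 oV1 V1e] := householder (sqn_delta R (0 : 'I_(1 + n))) v1.
pose N := U1^T *m M *m V1.
have Nle x : sqn (N *m x) <= s ^+ 2 * sqn x.
  rewrite /N -!mulmxA (sqn_orthogonal _ (orthogonal_mx_tr oU1)) s2.
  by rewrite -(sqn_orthogonal x oV1).
have Ne i : N i 0 = s * (i == 0)%:R.
  have -> : N i 0 = (N *m (delta_mx 0 0 : 'cV_(1 + n))) i 0.
    by rewrite -colE [RHS]mxE.
  rewrite /N -!mulmxA V1e Mv -scalemxAr -U1e mulmxA oU1 mul1mx !mxE.
  by rewrite eqxx andbT.
have MN : M = U1 *m N *m V1^T.
  rewrite /N !mulmxA (orthogonal_mulmx_tr oU1) mul1mx -mulmxA.
  by rewrite (orthogonal_mulmx_tr oV1) mulmx1.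
clearbody N.
have l0 p : lshift p (0 : 'I_1) = 0 by apply: val_inj.
pose r := ursubmx N.
have eNr : N = block_mx s%:M r 0 (drsubmx N).
  rewrite -[LHS]submxK; congr block_mx; apply/matrixP => i j.
    by rewrite !mxE !ord1 !l0 Ne eqxx mulr1.
  by rewrite !mxE ord1 l0 Ne mulr0.
(* Evaluating the norm bound at the vector with blocks s and r^T gives
   (s^2 + |r|^2)^2 <= s^2 * (s^2 + |r|^2), which forces r = 0. *)
have r0 : r = 0.
  apply/trmx_inj/eqP; rewrite trmx0 -sqn_eq0.
  have := Nle (col_mx s%:M r^T); rewrite {1}eNr mul_block_col !sqn_col_mx.
  have -> : s%:M *m s%:M + r *m r^T = (s ^+ 2 + sqn r^T)%:M :> 'M_1.
    by rewrite -scalar_mxM [r *m _]mx11_scalar -raddfD /sqn /dotv trmxK expr2.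
  have sM (a : R) : sqn (a%:M : 'M_1) = a ^+ 2 by rewrite sqnE big_ord1 mxE.
  rewrite !sM => h; have q0 := sqn_ge0 r^T; have := sqr_ge0 s.
  move: h q0 (sqn_ge0 (0 *m s%:M + drsubmx N *m r^T)).
  set q := sqn r^T; set t := s ^+ 2; set z := sqn _ => h q0 z0 t0.
  by rewrite -sqrf_eq0 eq_le sqr_ge0 andbT; nra.
have eN : N = block_mx s%:M 0 0 (drsubmx N) by rewrite {1}eNr r0.
set B := drsubmx N in eN.
exists U1, s, B, V1; split=> // [x|]; last by rewrite -eN.
have := Nle (col_mx 0 x); rewrite eN mul_block_col !mulmx0 mul0mx !add0r.
by rewrite !sqn_col_mx !sqn0 !add0r.
Qed.

Lemma svd_exists (R : realType) (m n : nat) (M : 'M[R]_(m, n)) :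
  exists U S V, full_svd M U S V.
Proof.
have base p q (N : 'M[R]_(p, q)) :
    ('I_p -> 'I_q -> False) -> exists U S V, full_svd N U S V.
  move=> F; exists 1%:M, N, 1%:M; rewrite /full_svd /orthogonal_mx !trmx1.
  rewrite !mul1mx mulmx1.
  by split=> //; split=> [i j|i j|i i' j j']; case: (F i j).
elim: m n M => [|m IH] [|n] M; try (by apply: base => -[]);
  try (by apply: base => i []).
have [U1 [s [B [V1 [oU1 oV1 s0 Ble eM]]]]] :=
  svd_deflation (M : 'M_(1 + m, 1 + n)).
have [U2 [S2 [V2 svdB]]] := IH _ B.
have [[oU2 oV2 eB] [dS pS sS]] := svdB.
have oblock p (W : 'M[R]_p) :
    orthogonal_mx W -> orthogonal_mx (block_mx (1%:M : 'M_1) 0 0 W).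
  move=> oW; rewrite /orthogonal_mx tr_block_mx !trmx0 trmx1 mulmx_block.
  by rewrite !mul0mx !mulmx0 !addr0 add0r mul1mx oW -scalar_mx_block.
have S2le (i : 'I_m) (j : 'I_n) : i = j :> nat -> S2 i j <= s.
  move=> ij; rewrite -ler_sqr ?nnegrE ?pS //.
  exact: svd_entry_le svdB Ble i j.
rewrite -[m.+1]/(1 + m)%N -[n.+1]/(1 + n)%N in M eM *.
exists (U1 *m block_mx 1%:M 0 0 U2), (block_mx s%:M 0 0 S2),
  (V1 *m block_mx 1%:M 0 0 V2).
split.
  split; try by apply: orthogonal_mx_mul => //; apply: oblock.
  rewrite eM trmx_mul !mulmxA; congr (_ *m _); rewrite -!mulmxA; congr (_ *m _).
  rewrite eB tr_block_mx !trmx0 trmx1 !mulmx_block.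
  by rewrite !(mul0mx, mulmx0, mul1mx, mulmx1, addr0, add0r) mulmxA.
split=> [i j|i j|i i' j j'].
- case: (split_ordP i) => {}i ->; case: (split_ordP j) => {}j -> ij.
  + by case: ij; rewrite !ord1.
  + by rewrite block_mxEur mxE.
  + by rewrite block_mxEdl mxE.
  + by rewrite block_mxEdr dS // => /(congr1 succn).
- case: (split_ordP i) => {}i ->; case: (split_ordP j) => {}j -> ij.
  + by rewrite block_mxEul mxE !ord1 eqxx.
  + by move: ij; rewrite /= !ord1.
  + by move: ij; rewrite /= !ord1.
  + by rewrite block_mxEdr pS //; case: ij.
- case: (split_ordP i) => {}i ->; case: (split_ordP j) => {}j -> ij;
    try (by move: ij; rewrite /= !ord1);
    case: (split_ordP i') => {}i' ->; case: (split_ordP j') => {}j' -> ij' ii';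
    try (by move: ij'; rewrite /= !ord1).
  + by rewrite block_mxEul block_mxEdr mxE !ord1 S2le //; case: ij'.
  + by move: ii'; rewrite /= !ord1.
  + by rewrite !block_mxEdr; apply: sS; [case: ij | case: ij' |].
Qed.

(** * The two-norm as an operator norm *)

Lemma full_svd_tr (R : realType) (m n : nat) (M : 'M[R]_(m, n)) U S V :
  full_svd M U S V -> full_svd M^T V S^T U.
Proof.
move=> [[oU oV eM] [dS pS sS]]; split; first split=> //.
  by rewrite eM !trmx_mul trmxK mulmxA.
split=> [i j ij|i j ij|i i' j j' ij ij' ii]; rewrite !mxE.
- by apply: dS => /esym.
- exact: pS.
- by apply: sS; rewrite -?ij -?ij'.
Qed.

Lemma norm2_tr (R : realType) (m n : nat) (M : 'M[R]_(m, n)) :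
  norm2 M^T = norm2 M.
Proof.
have sub p q (N : 'M[R]_(p, q)) s :
    singular_values N s -> singular_values N^T s.
  move=> [U [S [V [svdN [i [j [ij ->]]]]]]].
  by exists V, S^T, U; split; [apply: full_svd_tr | exists j, i; rewrite mxE].
congr sup; apply/seteqP; split=> s; last exact: sub.
by move=> /sub; rewrite trmxK.
Qed.

Lemma singular_values_ge0 (R : realType) (m n : nat) (M : 'M[R]_(m, n)) s :
  singular_values M s -> 0 <= s.
Proof. by move=> [U [S [V [[_ [_ pS _]] [i [j [ij ->]]]]]]]; apply: pS. Qed.

Lemma singular_values_le (R : realType) (m n : nat) (M : 'M[R]_(m, n)) (t : R) :
  (forall x, sqn (M *m x) <= t * sqn x) ->
  ubound (singular_values M) (Num.sqrt t).
Proof.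
move=> Mt s; move=> [U [S [V [svdM [i [j [ij ->]]]]]]].
have St := svd_entry_le svdM Mt i j; have [_ [_ pS _]] := svdM.
by rewrite -(ger0_norm (pS i j ij)) -sqrtr_sqr ler_wsqrtr.
Qed.

(** The supremum is an upper bound only because the set is bounded; the
    Frobenius norm provides a bound that is uniform over all SVDs. *)
Lemma singular_value_le_norm2 (R : realType) (m n : nat) (M : 'M[R]_(m, n)) s :
  singular_values M s -> s <= norm2 M.
Proof.
apply: ub_le_sup.
by eexists; apply: singular_values_le => x; apply: sqn_mulmx_frobenius.
Qed.

Lemma norm2_ge0 (R : realType) (m n : nat) (M : 'M[R]_(m, n)) : 0 <= norm2 M.
Proof.
have [s0|/set0P[s Ms]] := eqVneq (singular_values M) set0.
  by rewrite /norm2 s0 sup0.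
exact: le_trans (singular_values_ge0 Ms) (singular_value_le_norm2 Ms).
Qed.

(** Orthogonal factors preserve lengths, and a diagonal matrix stretches by at
    most its largest entry. *)
Lemma sqn_mulmx_norm2 (R : realType) (m n : nat) (M : 'M[R]_(m, n)) x :
  sqn (M *m x) <= norm2 M ^+ 2 * sqn x.
Proof.
have [U [S [V svdM]]] := svd_exists M; have [[oU oV eM] [dS pS _]] := svdM.
rewrite {1}eM -!mulmxA sqn_orthogonal //.
rewrite -(sqn_orthogonal x (orthogonal_mx_tr oV)).
apply: sqn_diag_le => // [i j ij|]; last exact: sqr_ge0.
rewrite ler_sqr ?nnegrE ?pS ?norm2_ge0 //; apply: singular_value_le_norm2.
by exists U, S, V; split=> //; exists i, j.
Qed.

Lemma norm2_sqr_le (R : realType) (m n : nat) (M : 'M[R]_(m, n)) (t : R) :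
  0 <= t -> (forall x, sqn (M *m x) <= t * sqn x) -> norm2 M ^+ 2 <= t.
Proof.
move=> t0 Mt; rewrite -[t in X in _ <= X]sqr_sqrtr //.
rewrite ler_sqr ?nnegrE ?norm2_ge0 ?sqrtr_ge0 //.
have [s0|/set0P Mn0] := eqVneq (singular_values M) set0.
  by rewrite /norm2 s0 sup0 sqrtr_ge0.
exact: ge_sup Mn0 (singular_values_le Mt).
Qed.

Lemma norm20 (R : realType) (m n : nat) : norm2 (0 : 'M[R]_(m, n)) = 0.
Proof.
apply/eqP; rewrite -sqrf_eq0 eq_le sqr_ge0 andbT; apply: norm2_sqr_le => // x.
by rewrite mul0mx sqn0 mul0r.
Qed.

Lemma norm2N (R : realType) (m n : nat) (M : 'M[R]_(m, n)) :
  norm2 (- M) = norm2 M.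
Proof.
suff le p q (N : 'M[R]_(p, q)) : norm2 (- N) <= norm2 N.
  by apply/le_anti; rewrite le //= -{1}[M]opprK le.
rewrite -ler_sqr ?nnegrE ?norm2_ge0 //; apply: norm2_sqr_le => [|x].
  exact: sqr_ge0.
by rewrite mulNmx -scaleN1r sqnZ sqrrN expr1n mul1r sqn_mulmx_norm2.
Qed.

(** * The Moore-Penrose inverse and orthogonal projectors *)

(** If v C^T C = 0 then |C v^T|^2 = v C^T C v^T = 0, so v = 0 because the
    columns of C are independent. *)
Lemma gram_unitmx (R : realType) (m r : nat) (C : 'M[R]_(m, r)) :
  row_free C^T -> C^T *m C \in unitmx.
Proof.
move=> fC; rewrite -row_free_unit -kermx_eq0; apply/rowV0P => v.
move=> /sub_kermxP vG; apply/(row_free_inj fC); rewrite mul0mx.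
apply/trmx_inj; rewrite trmx_mul trmxK trmx0; apply/eqP; rewrite -sqn_eq0.
by rewrite /sqn /dotv trmx_mul trmxK !mulmxA -(mulmxA v) vG mul0mx mxE.
Qed.

(** The explicit inverse attached to a full-rank factorization: the products
    with C F on either side are the projectors C (C^T C)^-1 C^T and
    F^T (F F^T)^-1 F, in which the symmetry is visible. *)
Lemma is_moore_penrose_factor (R : realType) (m n r : nat) (C : 'M[R]_(m, r))
    (F : 'M[R]_(r, n)) :
  row_free C^T -> row_free F ->
  is_moore_penrose (C *m F)
    (F^T *m invmx (F *m F^T) *m invmx (C^T *m C) *m C^T).
Proof.
move=> /gram_unitmx uC fF.
have uF : F *m F^T \in unitmx.
  by rewrite -[F in X in X *m _]trmxK; apply: gram_unitmx; rewrite trmxK.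
set G := C^T *m C in uC *; set K := F *m F^T in uF *.
have GT : G^T = G by rewrite /G trmx_mul trmxK.
have KT : K^T = K by rewrite /K trmx_mul trmxK.
have MX : C *m F *m (F^T *m invmx K *m invmx G *m C^T) = C *m invmx G *m C^T.
  by rewrite !mulmxA -(mulmxA C) -/K -(mulmxA C K) mulmxV // mulmx1.
have XM : F^T *m invmx K *m invmx G *m C^T *m (C *m F) = F^T *m invmx K *m F.
  by rewrite !mulmxA -(mulmxA _ C^T) -/G -(mulmxA _ _ G) mulVmx // mulmx1.
split.
- by rewrite MX !mulmxA -(mulmxA _ C^T) -/G -(mulmxA _ _ G) mulVmx // mulmx1.
- by rewrite XM !mulmxA -(mulmxA _ F) -/K -(mulmxA _ _ K) mulVmx // mulmx1.
- by rewrite MX !trmx_mul trmxK trmx_inv GT mulmxA.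
- by rewrite XM !trmx_mul trmxK trmx_inv KT mulmxA.
Qed.

Lemma moore_penroseP (R : realType) (m n : nat) (M : 'M[R]_(m, n)) :
  is_moore_penrose M (moore_penrose M).
Proof.
apply: (@xgetPex _ 0 [set X | is_moore_penrose M X]%classic).
rewrite -[M in is_moore_penrose M]mulmx_base; eexists.
apply: is_moore_penrose_factor; last exact: row_base_free.
by rewrite /row_free mxrank_tr -/(row_full _) col_base_full.
Qed.

Lemma moore_penrose_compl_mul (R : realType) (m n : nat) (M : 'M[R]_(m, n)) :
  (1%:M - M *m moore_penrose M) *m M = 0.
Proof.
by have [h _ _ _] := moore_penroseP M; rewrite mulmxBl mul1mx h subrr.
Qed.

Lemma orthogonal_projector_moore_penrose (R : realType) (m n : nat)
    (M : 'M[R]_(m, n)) : orthogonal_projector (M *m moore_penrose M).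
Proof.
by have [h1 _ h3 _] := moore_penroseP M; split; rewrite ?h3 // mulmxA h1.
Qed.

Lemma orthogonal_projector_compl (R : realType) (m : nat) (P : 'M[R]_m) :
  orthogonal_projector P -> orthogonal_projector (1%:M - P).
Proof.
move=> [PP PT]; split; last by rewrite linearB /= trmx1 PT.
by rewrite mulmxBl mul1mx mulmxBr mulmx1 PP subrr subr0.
Qed.

(** Pythagoras: |x|^2 = |P x|^2 + |x - P x|^2. *)
Lemma sqn_projector_le (R : realType) (m : nat) (P : 'M[R]_m) x :
  orthogonal_projector P -> sqn (P *m x) <= sqn x.
Proof.
move=> [PP PT]; have := sqn_ge0 (x - P *m x).
have -> : sqn (x - P *m x) = sqn x - sqn (P *m x); last by rewrite subr_ge0.
have e : dotv x (P *m x) = sqn (P *m x).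
  by rewrite -[in LHS]PP -mulmxA [LHS]dotv_mulmx PT.
by rewrite sqnB e; ring.
Qed.

Lemma norm2_projector_mul (R : realType) (m n : nat) (Q : 'M[R]_m)
    (M : 'M[R]_(m, n)) :
  orthogonal_projector Q -> norm2 (Q *m M) ^+ 2 <= norm2 M ^+ 2.
Proof.
move=> oQ; apply: norm2_sqr_le => [|x]; first exact: sqr_ge0.
rewrite -mulmxA; apply: le_trans (sqn_projector_le _ oQ) _.
exact: sqn_mulmx_norm2.
Qed.

(** * Comparison of two matrices through their Gram matrices *)

(** The two squared lengths are the quadratic forms of A A^T and B B^T at z, so
    their difference is the quadratic form of a matrix of known norm. *)
Lemma sqn_gram_le (R : realType) (m n c : nat) (A : 'M[R]_(m, n))
    (B : 'M[R]_(m, c)) z :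
  sqn (A^T *m z) <= sqn (B^T *m z) + norm2 (A *m A^T - B *m B^T) * sqn z.
Proof.
set D := _ - _.
have e p (N : 'M[R]_(m, p)) : sqn (N^T *m z) = dotv z (N *m N^T *m z).
  by rewrite -mulmxA dotv_mulmx.
rewrite -lerBlDl !e -dotvNr -dotvDr -mulmxBl -/D.
apply: le_trans (ler_norm _) _.
exact: (dotv_quad_le (norm2_ge0 D) (sqn_mulmx_norm2 D)).
Qed.

(** The norm of Q A is computed on its transpose A^T Q, so that the Gram
    matrices A A^T and B B^T enter. *)
Lemma norm2_residual_le (R : realType) (m n c : nat) (A : 'M[R]_(m, n))
    (B : 'M[R]_(m, c)) (Q : 'M[R]_m) :
  orthogonal_projector Q ->
  norm2 (Q *m A) ^+ 2 <= norm2 (Q *m B) ^+ 2 + norm2 (A *m A^T - B *m B^T).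
Proof.
move=> oQ; rewrite -norm2_tr; apply: norm2_sqr_le.
  by rewrite addr_ge0 ?sqr_ge0 ?norm2_ge0.
move=> y; rewrite trmx_mul -mulmxA; have [_ QT] := oQ.
apply: le_trans (sqn_gram_le A B _) _; rewrite mulrDl; apply: lerD.
  by rewrite mulmxA -trmx_mul -norm2_tr sqn_mulmx_norm2.
by rewrite ler_wpM2l ?norm2_ge0 // QT sqn_projector_le.
Qed.

(** * Low-rank approximation *)

(** A Weyl-type bound combined with the lower bound of Eckart and Young: the
    singular value of B of index i, counted from 0, is compared with the error
    of an arbitrary approximation L of A of rank at most i.  A space of
    dimension i + 1 meets the kernel of L^T. *)
Lemma svd_entry_le_low_rank (R : realType) (m n c : nat) (A L : 'M[R]_(m, n))
    (B : 'M[R]_(m, c)) U S V (i : 'I_m) (j : 'I_c) :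
  full_svd B U S V -> i = j :> nat -> (\rank L <= i)%N ->
  S i j ^+ 2 <= norm2 (A - L) ^+ 2 + norm2 (A *m A^T - B *m B^T).
Proof.
move=> [[oU oV eB] [dS pS sS]] ij rL.
pose f := widen_ord (ltn_ord i : (i.+1 <= m)%N); pose W := colsub f U.
have UW : U^T *m W = colsub f 1%:M by rewrite mulmx_colsub oU.
have WW : W^T *m W = 1%:M.
  by apply/matrixP => a b; rewrite trmx_mxsub -mxsub_mul oU !mxE.
have /rowV0Pn[z zk z0] : kermx (W^T *m L) != 0.
  rewrite -mxrank_eq0 mxrank_ker subn_eq0 -ltnNge ltnS.
  exact: leq_trans (mxrankM_maxr _ _) rL.
have Lz : L^T *m (W *m z^T) = 0.
  move/sub_kermxP: zk => /(congr1 trmx).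
  by rewrite !trmx_mul trmxK trmx0 mulmxA.
pose w := W *m z^T; have ww : sqn w = sqn z^T by rewrite sqn_orthogonal.
have wgt0 : 0 < sqn w.
  by rewrite ww lt_def sqn_ge0 sqn_eq0 trmx_eq0 z0.
(* The diagonal entries decrease, so S i j is the least of the first i + 1. *)
have lo : S i j ^+ 2 * sqn w <= sqn (B^T *m w).
  rewrite eB !trmx_mul trmxK -!mulmxA sqn_orthogonal // (mulmxA U^T) UW.
  rewrite mulmxA mulmx_colsub mulmx1 sqn_diag; last first.
    by move=> a b ab; rewrite !mxE; apply: dS => /esym.
  rewrite ww sqnE mulr_sumr; apply: ler_sum => b _.
  rewrite ler_wpM2r ?sqr_ge0 //.
  have bc : (b < c)%N by rewrite (leq_ltn_trans _ (ltn_ord j)) // -ij -ltnS.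
  rewrite (bigD1 (Ordinal bc)) //= !mxE -[leLHS]addr0 lerD //; last first.
    by apply: sumr_ge0 => a _; apply: sqr_ge0.
  by rewrite ler_sqr ?nnegrE ?pS // sS //= -ltnS.
have hi : sqn (A^T *m w) <= norm2 (A - L) ^+ 2 * sqn w.
  rewrite -norm2_tr -[A^T *m w]subr0 -Lz -mulmxBl -linearB.
  exact: sqn_mulmx_norm2.
have mid := sqn_gram_le B A w.
rewrite -(ler_pM2r wgt0) (le_trans lo) // (le_trans mid) // mulrDl.
by rewrite lerD // -opprB norm2N.
Qed.

Lemma colsub_widen_proj (R : realType) (k m : nat) (km : (k <= m)%N) :
  colsub (widen_ord km) 1%:M *m (colsub (widen_ord km) 1%:M)^T =
  diag_mx (\row_(i < m) (i < k)%:R) :> 'M[R]_m.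
Proof.
have -> : colsub (widen_ord km) 1%:M = pid_mx k :> 'M[R]_(m, k).
  apply/matrixP => i j; rewrite !mxE -val_eqE /=.
  by case: eqP => [->|//]; rewrite ltn_ord.
rewrite tr_pid_mx mul_pid_mx minnn; apply/matrixP => i j; rewrite !mxE minnn.
by rewrite -val_eqE; case: eqP => //= ->; case: (_ < _)%N.
Qed.

(** The submatrix product, rewritten in the frame of the original SVD so that it
    can be subtracted from U S V^T. *)
Lemma truncated_svdE (R : realType) (m n k : nat) (U : 'M[R]_m)
    (S : 'M[R]_(m, n)) (V : 'M[R]_n) (km : (k <= m)%N) (kn : (k <= n)%N) :
  colsub (widen_ord km) U *m mxsub (widen_ord km) (widen_ord kn) S
    *m (colsub (widen_ord kn) V)^T =
  U *m (\matrix_(i, j) ((i < k)%:R * S i j * (j < k)%:R)) *m V^T.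
Proof.
set E := colsub (widen_ord km) (1%:M : 'M[R]_m).
set G := colsub (widen_ord kn) (1%:M : 'M[R]_n).
have cE p q (f : 'I_q -> 'I_p) (W : 'M[R]_p) :
    colsub f W = W *m colsub f 1%:M by rewrite mulmx_colsub mulmx1.
rewrite (cE _ _ _ U) (cE _ _ _ V) -/E -/G trmx_mul.
have -> : mxsub (widen_ord km) (widen_ord kn) S = E^T *m S *m G.
  rewrite mulmx_colsub mulmx1 mxsubcr; congr (mxsub id _ _).
  by rewrite /E trmx_mxsub trmx1 mul_rowsub_mx mul1mx.
rewrite !mulmxA -(mulmxA U E) -(mulmxA _ G) /E /G !colsub_widen_proj.
rewrite -[U *m _ *m S]mulmxA -[U *m _ *m diag_mx _]mulmxA; congr (_ *m _ *m _).
by apply/matrixP => i j; rewrite mul_diag_mx mul_mx_diag !mxE.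
Qed.

(** Truncating leaves the singular values of index at least k.  The hypothesis
    ranges over all SVDs because the one that produced [Mk] is hidden in
    [best_rank_approx]. *)
Lemma best_rank_approx_residual (R : realType) (m n k : nat)
    (M Mk : 'M[R]_(m, n)) (t : R) :
  best_rank_approx k M Mk -> 0 <= t ->
  (forall U S V (i : 'I_m) (j : 'I_n), full_svd M U S V -> i = j :> nat ->
    (k <= i)%N -> S i j ^+ 2 <= t) ->
  norm2 (M - Mk) ^+ 2 <= t.
Proof.
move=> [_ [U [S [V [km [kn [svdM ->]]]]]]] t0 St; apply: norm2_sqr_le => // x.
have {}St := St _ _ _ _ _ svdM; have [[oU oV {1}->] [dS _ _]] := svdM.
rewrite truncated_svdE -mulmxBl -mulmxBr -!mulmxA (sqn_orthogonal _ oU).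
rewrite -(sqn_orthogonal x (orthogonal_mx_tr oV)).
apply: sqn_diag_le => // i j ij; rewrite !mxE.
  by rewrite (dS _ _ ij) mulr0 mul0r subr0.
rewrite -ij; have [ik|ki] := ltnP i k.
  by rewrite mul1r mulr1 subrr expr0n.
by rewrite mulr0 subr0 St.
Qed.

Lemma best_rank_approx_rank (R : realType) (m n k : nat)
    (M Mk : 'M[R]_(m, n)) : best_rank_approx k M Mk -> (\rank Mk <= k)%N.
Proof.
move=> [_ [U [S [V [km [kn [_ ->]]]]]]].
by rewrite -mulmxA (leq_trans (mxrankM_maxl _ _)) // rank_leq_col.
Qed.

Unset Implicit Arguments.

Theorem theorem3 (R : realType) (m n c : nat)
    (A : 'M[R]_(m, n)) (At : 'M[R]_(m, c)) (P : 'M[R]_m)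
    (hP : orthogonal_projector P) (rP : \rank P = c) :
  [/\ `| norm2 ((1%:M - P) *m A) ^+ 2 - norm2 ((1%:M - P) *m At) ^+ 2 |
        <= norm2 (A *m A^T - At *m At^T),
      (\rank At = c ->
        norm2 ((1%:M - At *m moore_penrose At) *m A) ^+ 2
          <= norm2 (A *m A^T - At *m At^T)) &
      (forall (k : nat) (Ak : 'M[R]_(m, n)) (Atk : 'M[R]_(m, c)),
        best_rank_approx k A Ak ->
        best_rank_approx k At Atk ->
        \rank Atk = k ->
        (k < c)%N ->
        norm2 ((1%:M - Atk *m moore_penrose Atk) *m A) ^+ 2
          <= norm2 (A - Ak) ^+ 2 + 2 * norm2 (A *m A^T - At *m At^T))].
Proof.
have oC p (M : 'M[R]_(m, p)) :
    orthogonal_projector (1%:M - M *m moore_penrose M).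
  exact/orthogonal_projector_compl/orthogonal_projector_moore_penrose.
split=> [|_|k Ak Atk bA bAt _ _].
- have oQ := orthogonal_projector_compl hP.
  have AAt := norm2_residual_le A At oQ; have := norm2_residual_le At A oQ.
  rewrite -[norm2 (At *m _ - _)]norm2N opprB => AtA.
  by rewrite ler_norml lerBlDl AAt lerNl opprB lerBlDl AtA.
- have := norm2_residual_le A At (oC _ At).
  by rewrite moore_penrose_compl_mul norm20 expr0n add0r.
apply: le_trans (norm2_residual_le A At (oC _ Atk)) _.
rewrite [2 * _]mulr_natl mulr2n addrA lerD2r.
have -> : (1%:M - Atk *m moore_penrose Atk) *m At =
          (1%:M - Atk *m moore_penrose Atk) *m (At - Atk).
  by rewrite [RHS]mulmxBr moore_penrose_compl_mul subr0.
apply: le_trans (norm2_projector_mul _ (oC _ Atk)) _.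
apply: best_rank_approx_residual bAt _ _.
  by rewrite addr_ge0 ?sqr_ge0 ?norm2_ge0.
move=> U S V i j svdAt ij ki; apply: svd_entry_le_low_rank svdAt ij _.
exact: leq_trans (best_rank_approx_rank bA) ki.
Qed.
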